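(* Consider an instance of fair $k$-center: a finite metric space $(X,d)$ with $|X|=n$, a group assignment $g:X\to\{1,\dots,m\}$, and capacities $k_1,\dots,k_m$ with $k=\sum_j k_j$. Let $\mathrm{OPT}$ be the minimum clustering cost for $X$ of a feasible set, and let $\tau\ge \mathrm{OPT}$. Run the following two-pass algorithm: (1) (Pass 1) Compute $P$ by scanning $X$ in an arbitrary order, starting with $P$ containing the first point, and adding each scanned point $q$ to $P$ whenever $\min_{p\in P} d(p,q)>2\tau$. (2) (Pass 2) For each $q\in P$, initialize $N(q)=\{q\}$; scan $X$ in an arbitrary order and, for each scanned point $x$ and each $q\in P$, add $x$ to $N(q)$ if $d(q,x)\le\tau$ and $N(q)$ does not yet contain a point of group $g(x)$. (3) Output a feasible set $S\subseteq\bigcup_{q\in P}N(q)$ which intersects the maximum possible number of the sets $N(q)$, $q\in P$, among all feasible subsets of $\bigcup_{q\in P}N(q)$. Then the output $S$ is feasible and its clustering cost for $X$ is at most $3\tau$. In particular, if $\tau\in[\mathrm{OPT},(1+\varepsilon)\mathrm{OPT}]$ for some $\varepsilon>0$, the output is a $3(1+\varepsilon)$-approximation.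
   Context: For nonempty $A,B\subseteq X$, the clustering cost of $A$ for $B$ is $\max_{b\in B}\min_{a\in A}d(a,b)$. A set $S\subseteq X$ is feasible if for every group $j$ it contains at most $k_j$ points $x$ with $g(x)=j$. The fair $k$-center problem asks for a feasible set of minimum clustering cost for $X$; this minimum is denoted $\mathrm{OPT}$. *)

(* Defs.v *)
From mathcomp Require Export all_boot all_order all_algebra.
From mathcomp Require Export reals constructive_ereal.

Set Implicit Arguments.
Unset Strict Implicit.
Unset Printing Implicit Defensive.
Export Order.TTheory GRing.Theory Num.Theory.
Local Open Scope ring_scope.

Definition is_metric (R : realType) (X : finType) (d : X -> X -> R) : Prop :=
  [/\ forall x y, 0 <= d x y,
      forall x y, d x y = 0 <-> x = y,
      forall x y, d x y = d y x &
      forall x y z, d x z <= d x y + d y z].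

(* Minima over the empty set are +oo and maxima over the empty set are -oo, so
   the empty set of centers has cost +oo for any nonempty set of points. *)
Definition dist_to (R : realType) (X : finType) (d : X -> X -> R)
    (A : {set X}) (b : X) : \bar R :=
  \big[Order.min/+oo%E]_(a in A) (d a b)%:E.

Definition cost (R : realType) (X : finType) (d : X -> X -> R)
    (A B : {set X}) : \bar R :=
  \big[Order.max/-oo%E]_(b in B) dist_to d A b.

Definition feasible (X : finType) (m : nat) (g : X -> 'I_m)
    (cap : 'I_m -> nat) (S : {set X}) : bool :=
  [forall j, #|[set x in S | g x == j]| <= cap j]%N.

(* OPT is +oo exactly when X is nonempty and no nonempty set is feasible. *)
Definition OPT (R : realType) (X : finType) (d : X -> X -> R) (m : nat)
    (g : X -> 'I_m) (cap : 'I_m -> nat) : \bar R :=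
  \big[Order.min/+oo%E]_(S : {set X} | feasible g cap S) cost d S [set: X].

Definition approximation (R : realType) (X : finType) (d : X -> X -> R)
    (m : nat) (g : X -> 'I_m) (cap : 'I_m -> nat) (alpha : R)
    (S : {set X}) : Prop :=
  feasible g cap S /\ (cost d S [set: X] <= alpha%:E * OPT d g cap)%E.

Definition scan_order (X : finType) (s : seq X) : bool := perm_eq s (enum X).

Definition pass1_step (R : realType) (X : finType) (d : X -> X -> R) (tau : R)
    (P : {set X}) (q : X) : {set X} :=
  if ((2 * tau)%:E < dist_to d P q)%E then q |: P else P.

Definition pass1 (R : realType) (X : finType) (d : X -> X -> R) (tau : R)
    (s : seq X) : {set X} :=
  if s is x :: s' then foldl (pass1_step d tau) [set x] s' else set0.

(* One scanned point x updates all the sets N q at once; only the values at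
   centers q found by the first pass are used. *)
Definition pass2_step (R : realType) (X : finType) (d : X -> X -> R) (m : nat)
    (g : X -> 'I_m) (tau : R) (N : X -> {set X}) (x : X) : X -> {set X} :=
  fun q => if (d q x <= tau) && [forall y in N q, g y != g x]
           then x |: N q else N q.

Definition pass2 (R : realType) (X : finType) (d : X -> X -> R) (m : nat)
    (g : X -> 'I_m) (tau : R) (s : seq X) : X -> {set X} :=
  foldl (pass2_step d g tau) (fun q => [set q]) s.

Definition hits (X : finType) (P : {set X}) (N : X -> {set X})
    (S : {set X}) : nat :=
  #|[set q in P | S :&: N q != set0]|.

Definition max_hitting (X : finType) (m : nat) (g : X -> 'I_m)
    (cap : 'I_m -> nat) (P : {set X}) (N : X -> {set X})
    (S : {set X}) : Prop :=
  [/\ feasible g cap S,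
      S \subset \bigcup_(q in P) N q &
      forall S' : {set X}, feasible g cap S' ->
        S' \subset \bigcup_(q in P) N q -> (hits P N S' <= hits P N S)%N].

Definition algorithm_output (R : realType) (X : finType) (d : X -> X -> R)
    (m : nat) (g : X -> 'I_m) (cap : 'I_m -> nat) (tau : R) (s1 s2 : seq X)
    (S : {set X}) : Prop :=
  max_hitting g cap (pass1 d tau s1) (pass2 d g tau s2) S.

(* Main.v *)
(** Let [S0] be a feasible set of cost at most [tau], and map each pass-1 center
    [q] to a point [c q] of [S0] within [tau] of it. Centers are pairwise more
    than [2 tau] apart, so [c] is injective on them. Pass 2 keeps in [N q] a
    representative of every group that occurs within [tau] of [q], hence a point
    [y q] of the group of [c q]; by injectivity of [c] the set of all [y q] is
    feasible, and it hits every [N q]. The output therefore also hits every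
    [N q], and any point is within [2 tau] of some center [q], itself within
    [tau] of an output point. *)

Require Import Defs.
From mathcomp Require Import all_boot all_order all_algebra.
From mathcomp Require Import reals constructive_ereal.
From mathcomp Require Import boolp lra.

Local Open Scope ring_scope.

Section Clustering.

Variables (R : realType) (X : finType) (d : X -> X -> R).
Implicit Types (A B P S : {set X}) (tau r : R).

(** The default [+oo] of the minimum is never below a real [r], so a finite bound always yields an
    actual center. *)
Lemma dist_to_leP A b r :
  reflect (exists2 a, a \in A & d a b <= r) (dist_to d A b <= r%:E)%E.
Proof.
apply: (iffP (bigmin_leP _ _ _ _)) => [[//|] | [a aA ab]].
- by case=> a aA; rewrite lee_fin; exists a.
- by right; exists a; rewrite ?lee_fin.
Qed.

Lemma cost_leP A B r :
  reflect (forall b, b \in B -> exists2 a, a \in A & d a b <= r)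
          (cost d A B <= r%:E)%E.
Proof.
apply: (iffP (bigmax_leP _ _ _ _)) => [[_ le_r] b bB | le_r].
- exact/dist_to_leP/le_r.
- by split=> [|b bB]; [exact: leNye | apply/dist_to_leP/le_r].
Qed.

Lemma OPT_leP (m : nat) (g : X -> 'I_m) (cap : 'I_m -> nat) r :
  reflect (exists2 S, feasible g cap S & (cost d S [set: X] <= r%:E)%E)
          (OPT d g cap <= r%:E)%E.
Proof.
by apply: (iffP (bigmin_leP _ _ _ _)) => [[]//|]; right.
Qed.

Definition separated r P : Prop :=
  {in P &, forall p q, p != q -> r < d p q}.

Lemma pass1_step_separated tau P q : (forall x y, d x y = d y x) ->
  separated (2 * tau) P -> separated (2 * tau) (pass1_step d tau P q).
Proof.
move=> dC sepP; rewrite /pass1_step; case: ifP => // far.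
have farP p : p \in P -> 2 * tau < d p q.
  move=> pP; rewrite ltNge; apply/negP => pq.
  by move: far; rewrite ltNge => /negP; apply; apply/dist_to_leP; exists p.
move=> u v; rewrite !inE => /predU1P[->|uP] /predU1P[->|vP] uv.
- by rewrite eqxx in uv.
- by rewrite dC farP.
- exact: farP.
- exact: sepP.
Qed.

Lemma pass1_separated tau s : (forall x y, d x y = d y x) ->
  separated (2 * tau) (pass1 d tau s).
Proof.
move=> dC; case: s => [|x s] /=; first by move=> p q; rewrite inE.
have: separated (2 * tau) [set x].
  by move=> p q /set1P-> /set1P->; rewrite eqxx.
elim: s [set x] => //= q s IHs P sepP.
exact/IHs/pass1_step_separated.
Qed.

Lemma pass1_foldl_sub tau s P : P \subset foldl (pass1_step d tau) P s.
Proof.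
elim: s P => //= q s IHs P; apply: subset_trans (IHs _).
by rewrite /pass1_step; case: ifP; rewrite // subsetUr.
Qed.

(** When scanned, [x] either becomes a center and covers itself, or is rejected because of a center
    within [2 * tau]; centers are never removed afterwards. *)
Lemma pass1_cover tau s x : (forall y, d y y <= 2 * tau) -> x \in s ->
  exists2 p, p \in pass1 d tau s & d p x <= 2 * tau.
Proof.
move=> d0; case: s => // y s /predU1P[->|] /=.
  by exists y; rewrite // (subsetP (pass1_foldl_sub tau s _)) ?set11.
elim: s [set y] => //= q s IHs P /predU1P[->|xs]; last exact: IHs.
suff [p pP pq]: exists2 p : X, p \in pass1_step d tau P q & d p q <= 2 * tau.
  by exists p; rewrite // (subsetP (pass1_foldl_sub tau s _)).
rewrite /pass1_step; case: ifPn => [_ | ]; last by rewrite -leNgt => /dist_to_leP.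
by exists q; rewrite // setU11.
Qed.

Variables (m : nat) (g : X -> 'I_m).

(** Every added point passes the test against [tau]; the bound on [d y y] accounts for the initial
    point [q]. *)
Lemma pass2_ball tau s q x : (forall y, d y y <= tau) ->
  x \in pass2 d g tau s q -> d q x <= tau.
Proof.
move=> d0; rewrite /pass2; set N0 := (X in foldl _ X _).
have: forall y, y \in N0 q -> d q y <= tau by move=> y /set1P->.
elim: s N0 => /= [N NP|z s IHs N NP]; first exact: NP.
apply: IHs => y; rewrite /pass2_step; case: ifP => [/andP[qz _]|_]; last exact: NP.
by case/setU1P=> [->|/NP].
Qed.

Lemma pass2_foldl_sub tau s (N : X -> {set X}) q :
  N q \subset foldl (pass2_step d g tau) N s q.
Proof.
elim: s N => //= z s IHs N; apply: subset_trans (IHs _).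
by rewrite /pass2_step; case: ifP; rewrite // subsetUr.
Qed.

(** When [x] is scanned, it is refused only if its group is already represented, and later steps
    only enlarge the set. *)
Lemma pass2_group tau s q x : x \in s -> d q x <= tau ->
  exists2 y, y \in pass2 d g tau s q & g y = g x.
Proof.
move=> xs qx; move: xs; rewrite /pass2; set N0 := (X in foldl _ X _).
elim: s N0 => //= z s IHs N /predU1P[<-|xs]; last exact: IHs.
suff [y yN gy]: exists2 y, y \in pass2_step d g tau N x q & g y = g x.
  by exists y; rewrite // (subsetP (pass2_foldl_sub tau s _ q)).
rewrite /pass2_step qx /=; case: ifPn => [_ | ].
  by exists x; rewrite // setU11.
by case/forall_inPn => y yN /negPn/eqP; exists y.
Qed.

Variable cap : 'I_m -> nat.

(** Points of [y @: P] in group [j] come from centers [q] with [c q] in group [j]. Injectivity of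
    [c] bounds the number of these centers by the count for [S], and collisions of [y] only lower
    it. *)
Lemma feasible_exchange S P (c y : X -> X) :
  feasible g cap S -> {in P, forall q, c q \in S} -> {in P &, injective c} ->
  {in P, forall q, g (y q) = g (c q)} -> feasible g cap (y @: P).
Proof.
move=> /forallP feasS cS c_inj gyc; apply/forallP => j.
set Pj := [set q in P | g (c q) == j].
have yPj : [set x in y @: P | g x == j] \subset y @: Pj.
  apply/subsetP => x; rewrite inE => /andP[/imsetP[q qP ->] gj].
  by rewrite imset_f // inE qP -gyc.
apply: leq_trans (subset_leq_card yPj) _; apply: leq_trans (leq_imset_card _ _) _.
have <- : #|c @: Pj| = #|Pj|.
  apply: card_in_imset => u v; rewrite !inE => /andP[uP _] /andP[vP _].
  exact: c_inj.
apply: leq_trans (feasS j); apply: subset_leq_card.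
apply/subsetP => x /imsetP[q qPj ->]; move: qPj; rewrite !inE => /andP[qP gj].
by rewrite cS.
Qed.

(** The set [y @: P] is an admissible competitor hitting all [#|P|] sets, so a maximizer must do the
    same. *)
Lemma max_hitting_all P (N : X -> {set X}) S (y : X -> X) :
  max_hitting g cap P N S -> {in P, forall q, y q \in N q} ->
  feasible g cap (y @: P) ->
  {in P, forall q, exists2 x, x \in S & x \in N q}.
Proof.
case=> _ _ maxS yN feas_y q qP.
have sub_y : y @: P \subset \bigcup_(p in P) N p.
  by apply/subsetP => _ /imsetP[p pP ->]; apply/bigcupP; exists p; rewrite ?yN.
have: P \subset [set p in P | S :&: N p != set0].
  have subP : [set p in P | S :&: N p != set0] \subset P.
    by apply/subsetP => p; rewrite inE => /andP[].
  (* The hit centers form a subset of [P], so it suffices to compare cardinals. *)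
  rewrite -(subset_leqif_card subP).2 eqn_leq subset_leq_card //=.
  apply: leq_trans (maxS _ feas_y sub_y); apply: subset_leq_card.
  apply/subsetP => p pP; rewrite inE pP; apply/set0Pn; exists (y p).
  by rewrite inE imset_f // yN.
by move/subsetP/(_ q qP); rewrite inE => /andP[_ /set0Pn[x /setIP[]]]; exists x.
Qed.

Lemma algorithm_output_cost tau (s1 s2 : seq X) S : is_metric d ->
  (OPT d g cap <= tau%:E)%E -> scan_order s1 -> scan_order s2 ->
  algorithm_output d g cap tau s1 s2 S ->
  (cost d S [set: X] <= (3 * tau)%:E)%E.
Proof.
case=> d_ge0 d_eq0 dC d_tri /OPT_leP[S0 feas0 /cost_leP cost0] scan1 scan2 outS.
have in_s1 x : x \in s1 by rewrite (perm_mem scan1) mem_enum.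
have in_s2 x : x \in s2 by rewrite (perm_mem scan2) mem_enum.
have /fin_all_exists2[c cS0 cd] : forall q, exists2 a, a \in S0 & d a q <= tau.
  by move=> q; apply: cost0; rewrite inE.
have d0 x : d x x = 0 by apply/d_eq0.
apply/cost_leP => x _.
(* The sign of [tau] is derived only after a point [x] is given, since [X] may be empty. *)
have tau_ge0 : 0 <= tau by apply: le_trans (d_ge0 _ _) (cd x).
have dN q z : z \in pass2 d g tau s2 q -> d q z <= tau.
  by apply: pass2_ball => w; rewrite d0.
have /fin_all_exists2[y yN gy] :
    forall q, exists2 z, z \in pass2 d g tau s2 q & g z = g (c q).
  by move=> q; apply: pass2_group; rewrite // dC.
have c_inj : {in pass1 d tau s1 &, injective c}.
  move=> p q pP qP cpq; apply/eqP; apply: contraT => pq.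
  have := pass1_separated tau s1 dC p q pP qP pq.
  (* A shared image would put [p] and [q] within [2 * tau] of each other. *)
  have := d_tri p (c p) q; rewrite (dC p (c p)) {2}cpq.
  by have := cd p; have := cd q; lra.
have [|//|p pP px] := @pass1_cover tau s1 x; first by move=> z; rewrite d0; lra.
have feas_y : feasible g cap (y @: pass1 d tau s1).
  by apply: (@feasible_exchange S0 _ c) => // q _.
have [//|z zS zN] := max_hitting_all _ _ _ y outS _ feas_y p pP.
exists z => //; have := d_tri z p x; rewrite (dC z p).
by have := dN _ _ zN; lra.
Qed.

End Clustering.

Theorem theorem1 (R : realType) (X : finType) (d : X -> X -> R) (n m k : nat)
    (g : X -> 'I_m) (cap : 'I_m -> nat) (tau : R) (s1 s2 : seq X)
    (S : {set X}) :
  is_metric d ->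
  #|X| = n ->
  k = (\sum_(j < m) cap j)%N ->
  (OPT d g cap <= tau%:E)%E ->
  scan_order s1 ->
  scan_order s2 ->
  algorithm_output d g cap tau s1 s2 S ->
  [/\ feasible g cap S,
      (cost d S [set: X] <= (3 * tau)%:E)%E &
      forall eps : R, 0 < eps ->
        (OPT d g cap <= tau%:E)%E ->
        (tau%:E <= (1 + eps)%:E * OPT d g cap)%E ->
        approximation d g cap (3 * (1 + eps)) S].
Proof.
move=> dm _ _ opt scan1 scan2 outS.
have [feasS _ _] := outS.
have costS := algorithm_output_cost _ _ _ _ _ _ _ _ _ _ dm opt scan1 scan2 outS.
split=> // eps eps_gt0 _ tau_le; split=> //.
(* Factoring out the nonnegative constant 3 leaves [tau_le], with no case split on whether [OPT] is
   finite. *)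
apply: le_trans costS _; rewrite !EFinM -muleA.
by apply: lee_wpmul2l tau_le; rewrite lee_fin.
Qed.
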